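(* The CFC elements in type $D_{n+1}$ are exactly those having reduced expressions in which each generator occurs at most once. Moreover, $D_1^{CFC}(q)=1+q$, $D_2^{CFC}(q)=1+2q+q^2$, $D_3^{CFC}(q)=1+3q+5q^2+4q^3$, and for $n\ge 3$, $$D_{n+1}^{CFC}(q)=(2q+1)D_n^{CFC}(q)-q\,D_{n-1}^{CFC}(q).$$ In other words, $$D^{CFC}(x):=\sum_{n=0}^{\infty}D_{n+1}^{CFC}(q)x^n=\frac{(1+q)-xq(1+q)+x^2q^2(1+2q)}{1-(2q+1)x+qx^2}.$$
   Context: $D_{n+1}$ is the Coxeter group with generators $t_1,t_2,s_1,\dots,s_{n-1}$ whose Coxeter diagram has edges $t_1-s_1$, $t_2-s_1$, $s_i-s_{i+1}$ ($1\le i\le n-2$), all with $m=3$ (all other pairs commute). For small index: $D_2$ is generated by the two commuting generators $t_1,t_2$, and $D_3$ has the path diagram $t_1-s_1-t_2$; $D_1$ is by convention the group with one generator, so that $D_1^{CFC}(q)=1+q$. For a Coxeter group $W$ with length $\ell$, an element is fully commutative (FC) if any two of its reduced expressions are related by a sequence of transpositions of adjacent commuting generators. A cyclic shift of a word $s_{i_1}\cdots s_{i_k}$ is any word $s_{i_j}\cdots s_{i_k}s_{i_1}\cdots s_{i_{j-1}}$. An element is cyclically fully commutative (CFC) if every cyclic shift of every one of its reduced expressions is a reduced expression of an FC element. $W^{CFC}$ is the set of CFC elements, and $W^{CFC}(q)=\sum_{w\in W^{CFC}}q^{\ell(w)}$. *)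

(* Defs.v *)
From HB Require Import structures.
From Stdlib Require Import Relations.
From mathcomp Require Import all_boot all_order all_algebra.
From mathcomp Require Import boolp classical_sets functions cardinality fsbigop.

Set Implicit Arguments.
Unset Strict Implicit.
Unset Printing Implicit Defensive.

Import GRing.Theory.

(* The value 0 encodes m(s, t) = infinity: the relation (st)^0 = 1 is void. *)
Record coxeter_matrix (S : choiceType) := CoxeterMatrix {
  coxeter_m :> S -> S -> nat;
  coxeter_m_sym : forall s t, coxeter_m s t = coxeter_m t s;
  coxeter_m_eq1 : forall s t, (coxeter_m s t == 1) = (s == t) }.

Section CoxeterGroup.

Variables (S : choiceType) (m : coxeter_matrix S).

(* The congruence on words generated by (st)^m(s,t) = 1.  Since m(s,s) = 1, *)
(* each letter is its own inverse, so the monoid presented in this way is   *)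
(* the Coxeter group of m.                                                  *)
Inductive coxeter_cong : seq S -> seq S -> Prop :=
| coxeter_rel s t : coxeter_cong (flatten (nseq (m s t) [:: s; t])) [::]
| coxeter_refl u : coxeter_cong u u
| coxeter_sym u v : coxeter_cong u v -> coxeter_cong v u
| coxeter_trans u v w :
    coxeter_cong u v -> coxeter_cong v w -> coxeter_cong u w
| coxeter_cat u u' v v' :
    coxeter_cong u u' -> coxeter_cong v v' ->
    coxeter_cong (u ++ v) (u' ++ v').

Definition coxeter_congb : rel (seq S) := fun u v => `[< coxeter_cong u v >].

Lemma coxeter_congb_equiv : equiv_class_of coxeter_congb.
Proof.
split=> [u|u v|v u w]; first by apply/asboolP; exact: coxeter_refl.
  by apply/asboolP/asboolP; exact: coxeter_sym.
by move=> /asboolP uv /asboolP vw; apply/asboolP; exact: coxeter_trans uv vw.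
Qed.

Canonical coxeter_equiv := EquivRelPack coxeter_congb_equiv.

Definition coxeter_group : Type := {eq_quot coxeter_equiv}%qT.

HB.instance Definition _ := Choice.on coxeter_group.
HB.instance Definition _ := EqQuotient.on coxeter_group.

Definition coxeter_class (u : seq S) : coxeter_group := (\pi u)%qT.
Definition coxeter_word (w : coxeter_group) : seq S := generic_quotient.repr w.

Lemma coxeter_wordK w : coxeter_class (coxeter_word w) = w.
Proof. exact: reprK. Qed.

Lemma coxeter_classP u v :
  coxeter_class u = coxeter_class v <-> coxeter_cong u v.
Proof.
split=> [/eqquotP/asboolP //|uv]; apply/eqquotP; exact/asboolP.
Qed.

Lemma coxeter_classK u : coxeter_cong (coxeter_word (coxeter_class u)) u.
Proof. by apply/coxeter_classP; exact: coxeter_wordK. Qed.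

Definition coxeter_one : coxeter_group := coxeter_class [::].
Definition coxeter_mul (x y : coxeter_group) : coxeter_group :=
  coxeter_class (coxeter_word x ++ coxeter_word y).
Definition coxeter_inv (x : coxeter_group) : coxeter_group :=
  coxeter_class (rev (coxeter_word x)).

Lemma coxeter_class_cat u v :
  coxeter_class (u ++ v) = coxeter_mul (coxeter_class u) (coxeter_class v).
Proof.
by apply/coxeter_classP/coxeter_sym/coxeter_cat; exact: coxeter_classK.
Qed.

Lemma coxeter_cong_rev u : coxeter_cong (rev u ++ u) [::].
Proof.
elim: u => [|s u IHu]; first exact: coxeter_refl.
have mss : m s s = 1%N by apply/eqP; rewrite coxeter_m_eq1.
have ss : coxeter_cong [:: s; s] [::].
  by have := coxeter_rel s s; rewrite mss.
rewrite rev_cons cat_rcons; apply: coxeter_trans IHu.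
apply: coxeter_cat (coxeter_refl _) _.
by rewrite -[u in X in coxeter_cong _ X]cat0s -[s :: s :: u]/([:: s; s] ++ u);
   apply: coxeter_cat ss (coxeter_refl _).
Qed.

Fact coxeter_mulA : associative coxeter_mul.
Proof.
move=> x y z; rewrite -[x]coxeter_wordK -[y]coxeter_wordK -[z]coxeter_wordK.
by rewrite -!coxeter_class_cat catA.
Qed.

Fact coxeter_mul1 : left_id coxeter_one coxeter_mul.
Proof.
by move=> x; rewrite -[x]coxeter_wordK -coxeter_class_cat.
Qed.

Fact coxeter_mulx1 : right_id coxeter_one coxeter_mul.
Proof.
by move=> x; rewrite -[x]coxeter_wordK -coxeter_class_cat cats0.
Qed.

Fact coxeter_mulV : left_inverse coxeter_one coxeter_inv coxeter_mul.
Proof.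
move=> x; rewrite -{2}[x]coxeter_wordK -coxeter_class_cat.
by apply/coxeter_classP; exact: coxeter_cong_rev.
Qed.

Fact coxeter_mulxV : right_inverse coxeter_one coxeter_inv coxeter_mul.
Proof.
move=> x; rewrite -{1}[x]coxeter_wordK -coxeter_class_cat.
apply/coxeter_classP; rewrite -{1}[coxeter_word x]revK.
exact: coxeter_cong_rev.
Qed.

HB.instance Definition _ := isGroup.Build coxeter_group
  coxeter_mulA coxeter_mul1 coxeter_mulx1 coxeter_mulV coxeter_mulxV.

Definition coxeter_gen (s : S) : coxeter_group := coxeter_class [:: s].

Definition word_prod (u : seq S) : coxeter_group :=
  (\prod_(s <- u) coxeter_gen s)%g.

Lemma word_prodE u : word_prod u = coxeter_class u.
Proof.
rewrite /word_prod; elim: u => [|s u IHu]; first by rewrite big_nil.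
by rewrite big_cons IHu -[s :: u]cat1s coxeter_class_cat.
Qed.

Lemma coxeter_length_subproof (w : coxeter_group) :
  exists k, `[< exists2 u, word_prod u = w & size u = k >].
Proof.
exists (size (coxeter_word w)); apply/asboolP; exists (coxeter_word w) => //.
by rewrite word_prodE coxeter_wordK.
Qed.

Definition coxeter_length (w : coxeter_group) : nat :=
  ex_minn (coxeter_length_subproof w).

Definition reduced_expr (u : seq S) (w : coxeter_group) : Prop :=
  word_prod u = w /\ size u = coxeter_length w.

Inductive comm_move : seq S -> seq S -> Prop :=
| CommMove a b s t :
    commute (coxeter_gen s) (coxeter_gen t) ->
    comm_move (a ++ [:: s; t] ++ b) (a ++ [:: t; s] ++ b).

Definition fully_commutative (w : coxeter_group) : Prop :=
  forall u v, reduced_expr u w -> reduced_expr v w ->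
    clos_refl_trans (seq S) comm_move u v.

Definition CFC (w : coxeter_group) : Prop :=
  forall u, reduced_expr u w ->
  forall i, exists2 w', reduced_expr (rot i u) w' & fully_commutative w'.

(* The sum \sum_(_ \in _) is 0 if CFC is infinite; it is a genuine sum      *)
(* whenever the group is finite, as in type D.                              *)
Definition CFC_poly : {poly int} :=
  (\sum_(w \in [set w | CFC w]%classic) ('X : {poly int})^+(coxeter_length w))%R.

End CoxeterGroup.

(* Type D of rank r, for r >= 1: vertex 0 is t_1, vertex 1 is t_2 (if r >= 2) *)
(* and vertex i.+1 is s_i for 1 <= i <= r - 2.                                *)
Section TypeD.

Variable r : nat.

Definition typeD_edge (i j : nat) : bool :=
  (i == 0) && (j == 2) || (0 < i) && (j == i.+1).

Definition typeD_m (i j : 'I_r) : nat :=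
  if i == j then 1 else if typeD_edge i j || typeD_edge j i then 3 else 2.

Fact typeD_m_sym i j : typeD_m i j = typeD_m j i.
Proof. by rewrite /typeD_m eq_sym orbC. Qed.

Fact typeD_m_eq1 i j : (typeD_m i j == 1) = (i == j).
Proof. by rewrite /typeD_m; case: ifP => // _; case: ifP. Qed.

Definition typeD : coxeter_matrix 'I_r := CoxeterMatrix typeD_m_sym typeD_m_eq1.

End TypeD.

Definition D_CFC (r : nat) : {poly int} := CFC_poly (typeD r).

Local Open Scope ring_scope.

Record fps (R : comUnitRingType) := Fps { fps_coef : nat -> R }.

Section FormalPowerSeries.

Variable R : comUnitRingType.
Implicit Types a b c : fps R.

HB.instance Definition _ := gen_eqMixin (fps R).
HB.instance Definition _ := gen_choiceMixin (fps R).

Lemma fpsP a b : fps_coef a =1 fps_coef b -> a = b.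
Proof. by case: a b => a [b] /= /funext ->. Qed.

Definition fps_const (r : R) : fps R := Fps (fun n => if n is 0 then r else 0).
Definition fpsX : fps R := Fps (fun n => (n == 1)%:R).

Definition fps_add a b := Fps (fun n => fps_coef a n + fps_coef b n).
Definition fps_opp a := Fps (fun n => - fps_coef a n).
Definition fps_mul a b :=
  Fps (fun n => \sum_(i < n.+1) fps_coef a i * fps_coef b (n - i)).

Fact fps_addA : associative fps_add.
Proof. by move=> a b c; apply: fpsP => n /=; rewrite addrA. Qed.

Fact fps_addC : commutative fps_add.
Proof. by move=> a b; apply: fpsP => n /=; rewrite addrC. Qed.

Fact fps_add0 : left_id (fps_const 0) fps_add.
Proof. by move=> a; apply: fpsP => -[|n] /=; rewrite add0r. Qed.

Fact fps_addN : left_inverse (fps_const 0) fps_opp fps_add.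
Proof. by move=> a; apply: fpsP => -[|n] /=; rewrite addNr. Qed.

HB.instance Definition _ := GRing.isZmodule.Build (fps R)
  fps_addA fps_addC fps_add0 fps_addN.

Definition fps_trunc N a : {poly R} := \poly_(i < N) fps_coef a i.

Lemma coef_fps_trunc N a n : (n < N)%N -> (fps_trunc N a)`_n = fps_coef a n.
Proof. by move=> nN; rewrite coef_poly nN. Qed.

Lemma coef_fps_mul N a b n : (n < N)%N ->
  fps_coef (fps_mul a b) n = (fps_trunc N a * fps_trunc N b)`_n.
Proof.
move=> nN; rewrite coefM /=; apply: eq_bigr => i _.
rewrite !coef_fps_trunc //; first exact: leq_ltn_trans (leq_subr _ _) nN.
by apply: leq_trans nN; apply: ltn_ord.
Qed.

Lemma coefM_eq (p q p' q' : {poly R}) n :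
  (forall i, (i <= n)%N -> p`_i = p'`_i) ->
  (forall i, (i <= n)%N -> q`_i = q'`_i) -> (p * q)`_n = (p' * q')`_n.
Proof.
move=> pp' qq'; rewrite !coefM; apply: eq_bigr => i _.
by rewrite pp' ?qq' ?leq_subr // -ltnS.
Qed.

Fact fps_mulA : associative fps_mul.
Proof.
move=> a b c; apply: fpsP => n; rewrite !(coef_fps_mul _ _ (ltnSn n)).
transitivity
  (fps_trunc n.+1 a * (fps_trunc n.+1 b * fps_trunc n.+1 c))`_n.
  by apply: coefM_eq => // i ile; rewrite coef_fps_trunc // (@coef_fps_mul n.+1).
rewrite mulrA.
by apply: coefM_eq => // i ile; rewrite coef_fps_trunc // (@coef_fps_mul n.+1).
Qed.

Fact fps_mulC : commutative fps_mul.
Proof.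
by move=> a b; apply: fpsP => n; rewrite !(coef_fps_mul _ _ (ltnSn n)) mulrC.
Qed.

Fact fps_mul1 : left_id (fps_const 1) fps_mul.
Proof.
move=> a; apply: fpsP => n /=; rewrite big_ord_recl subn0 mul1r big1 ?addr0 //.
by move=> i _; rewrite mul0r.
Qed.

Fact fps_mulD : left_distributive fps_mul fps_add.
Proof.
move=> a b c; apply: fpsP => n /=; rewrite -big_split.
by apply: eq_bigr => i _; rewrite mulrDl.
Qed.

Fact fps_1neq0 : fps_const 1 != 0 :> fps R.
Proof.
apply/eqP => /(congr1 (fun a : fps R => fps_coef a 0)) /= /eqP.
by rewrite oner_eq0.
Qed.

HB.instance Definition _ := GRing.Zmodule_isComNzRing.Build (fps R)
  fps_mulA fps_mulC fps_mul1 fps_mulD fps_1neq0.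

Definition fps_unit : {pred fps R} := fun a => `[< exists b, b * a = 1 >].

Definition fps_inv a : fps R :=
  if pselect (exists b, b * a = 1) is left ab then sval (cid ab) else a.

Fact fps_mulVx : {in fps_unit, left_inverse 1 fps_inv *%R}.
Proof.
move=> a /asboolP ab; rewrite /fps_inv; case: pselect => // ab'.
exact: svalP (cid ab').
Qed.

Fact fps_unitPl a b : b * a = 1 -> fps_unit a.
Proof. by move=> ba; apply/asboolP; exists b. Qed.

Fact fps_inv_out : {in [predC fps_unit], fps_inv =1 id}.
Proof.
by move=> a /asboolP ab; rewrite /fps_inv; case: pselect.
Qed.

HB.instance Definition _ := GRing.ComNzRing_hasMulInverse.Build (fps R)
  fps_mulVx fps_unitPl fps_inv_out.

Lemma fps_coefD a b n : fps_coef (a + b) n = fps_coef a n + fps_coef b n.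
Proof. by []. Qed.

Lemma fps_coefM a b n :
  fps_coef (a * b) n = \sum_(i < n.+1) fps_coef a i * fps_coef b (n - i).
Proof. by []. Qed.

Lemma fps_coef_sum (I : Type) (s : seq I) (F : I -> fps R) n :
  fps_coef (\sum_(i <- s) F i) n = \sum_(i <- s) fps_coef (F i) n.
Proof.
elim: s => [|i s IHs]; first by rewrite !big_nil; case: n.
by rewrite !big_cons fps_coefD IHs.
Qed.

Lemma fps_coefX_lt a k n :
  fps_coef a 0 = 0 -> (n < k)%N -> fps_coef (a ^+ k) n = 0.
Proof.
move=> a0; elim: k n => [//|k IHk] n nk.
rewrite exprS fps_coefM big1 // => -[[|i] ilt] _ /=; first by rewrite a0 mul0r.
rewrite IHk ?mulr0 //; rewrite !ltnS in ilt nk *.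
by apply: leq_trans nk; rewrite ltn_subrL (leq_ltn_trans _ ilt).
Qed.

(* Division by a series is meaningful exactly when its constant coefficient *)
(* is a unit; otherwise inversion is the identity.                          *)
Lemma fps_unitE a : (a \is a GRing.unit) = (fps_coef a 0 \is a GRing.unit).
Proof.
apply/idP/idP => [ua|ua0].
  apply/unitrPr; exists (fps_coef a^-1 0).
  have := congr1 (fun b : fps R => fps_coef b 0) (mulrV ua).
  by rewrite fps_coefM big_ord1.
pose d : fps R := fps_const (fps_coef a 0)^-1 * a.
have d0 : fps_coef d 0 = 1 by rewrite fps_coefM big_ord1 /= mulVr.
pose f := 1 - d.
have f0 : fps_coef f 0 = 0.
  by rewrite fps_coefD -[fps_coef (- d) 0]/(- fps_coef d 0) d0 subrr.
pose g : fps R := Fps (fun n => fps_coef (\sum_(k < n.+1) f ^+ k) n).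
suff gd : g * d = 1.
  by apply/unitrPr; exists (g * fps_const (fps_coef a 0)^-1);
     rewrite mulrC -mulrA.
apply: fpsP => n.
have gE i : (i <= n)%N -> fps_coef g i = fps_coef (\sum_(k < n.+1) f ^+ k) i.
  move=> ile; rewrite /= !fps_coef_sum.
  rewrite -!(big_mkord xpredT (fun k => fps_coef (f ^+ k) i)).
  rewrite (@big_cat_nat _ _ _ i.+1 0 n.+1) //=.
  rewrite [X in _ = _ + X]big_nat_cond [X in _ = _ + X]big1 ?addr0 // => k.
  by case/andP=> /andP[ik _] _; rewrite fps_coefX_lt.
transitivity (fps_coef ((\sum_(k < n.+1) f ^+ k) * d) n).
  by rewrite !fps_coefM; apply: eq_bigr => i _; rewrite gE // -ltnS.
have -> : (\sum_(k < n.+1) f ^+ k) * d = 1 - f ^+ n.+1.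
  apply: oppr_inj; rewrite opprB subrX1 mulrC -mulNr.
  by rewrite /f addrAC subrr add0r.
by rewrite fps_coefD /= fps_coefX_lt // subr0.
Qed.

End FormalPowerSeries.

(* Main.v *)
Require Import Defs.
From mathcomp Require Import all_boot all_order all_algebra.
From mathcomp Require Import boolp classical_sets functions cardinality fsbigop.
From mathcomp Require Import zify ring.
From Stdlib Require Import Relations.
Import GRing.Theory.

Set Implicit Arguments.
Unset Strict Implicit.
Unset Printing Implicit Defensive.

(** The proof has three ingredients.  Only the final step of the second and the
    application of the third use the shape of the diagram; the rest holds in
    every simply-laced Coxeter group.

    Uniq words (words without repeated letters) are well behaved.  Let the
    group act on integer functions on the generators by the contragredient of
    the reflection representation ([fire]): the fundamental weight of [s] is
    fixed by every generator but [s].  So the product of a uniq word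
    remembers its set of letters ([uniq_support]), and following the orbit of
    the weight shows that it also remembers the order of any two adjacent
    letters ([uniq_first_commutes]).  Hence a uniq word is reduced, and all
    reduced words of the same element are uniq and differ by commutations
    ([uniq_comm_equiv]).  Rotations of uniq words are uniq, so such elements
    are CFC ([uniq_CFC]).

    Conversely, let [s] occur at least twice in a reduced word of a CFC
    element.  Between two cyclically consecutive occurrences of [s] there are
    at least two neighbours of [s]: with none of them the word could be
    shortened, and with only one a braid move would change the number of
    [s]'s, which commutations cannot do ([fully_commutative_gap]).  So the
    numbers c(i) of occurrences satisfy 2 c(i) <= sum of c over the neighbours
    of i whenever c(i) >= 2 ([CFC_count]).  In type D, read from the far end
    of the long leg, the function c would then increase strictly from its
    first value above 1 up to the branch vertex, where the two short legs
    cannot compensate ([typeD_counts]); so c <= 1.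

    It remains to count elements with uniq words.  If a generator v has at
    most one neighbour in a set J of generators, an element with letters in J
    either avoids v, or is v times an element w avoiding v, or is w times v;
    the last two cases coincide exactly when w avoids the neighbour of v.
    This gives P(J) = (1 + 2q) P(J - v) - q P(J - v - neighbours of v)
    ([multfree_polyE]).  Applied to the initial segments of the vertices it
    yields the values in rank at most 3 and the recurrence, which is the
    generating function identity read coefficient by coefficient. *)

(** * Words and commutation moves *)

Section ReducedWords.

Variables (S : choiceType) (m : coxeter_matrix S).
Implicit Types (s t : S) (u v : seq S) (w : coxeter_group m).

Lemma word_prod_cons s u :
  word_prod m (s :: u) = (coxeter_gen m s * word_prod m u)%g.
Proof. by rewrite /word_prod big_cons. Qed.

Lemma word_prod_cat u v :
  word_prod m (u ++ v) = (word_prod m u * word_prod m v)%g.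
Proof. by rewrite /word_prod big_cat. Qed.

Lemma word_prod_rcons s u :
  word_prod m (rcons u s) = (word_prod m u * coxeter_gen m s)%g.
Proof. by rewrite -cats1 word_prod_cat /word_prod big_seq1. Qed.

Lemma reduced_le u v w : reduced_expr u w -> word_prod m v = w ->
  size u <= size v.
Proof.
case=> _ ->; rewrite /coxeter_length => vw; case: ex_minnP => k _; apply.
by apply/asboolP; exists v.
Qed.

Lemma reduced_eq_size u v w : reduced_expr u w -> word_prod m v = w ->
  size v = size u -> reduced_expr v w.
Proof. by rewrite /reduced_expr => -[_ <-]. Qed.

Lemma reduced_exists w : exists u, reduced_expr u w.
Proof.
rewrite /reduced_expr /coxeter_length; case: ex_minnP => k /asboolP[u uw uk] _.
by exists u.
Qed.

Lemma gen_invol s : (coxeter_gen m s * coxeter_gen m s)%g = 1%g.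
Proof.
have := coxeter_rel m s s; have /eqP -> : m s s == 1%N by rewrite coxeter_m_eq1.
by move/coxeter_classP; rewrite /= -cat1s coxeter_class_cat.
Qed.

Lemma gen_relation s t : ((coxeter_gen m s * coxeter_gen m t) ^+ m s t = 1)%g.
Proof.
have /coxeter_classP := coxeter_rel m s t.
rewrite -!word_prodE {2}/word_prod big_nil => <-.
elim: (m s t) => [|k IHk]; first by rewrite /word_prod big_nil.
by rewrite expgS IHk /= !word_prod_cons mulgA.
Qed.

Lemma comm_move_perm u v :
  clos_refl_trans (seq S) (comm_move m) u v -> perm_eq u v.
Proof.
elim=> [_ _ [a b s t _]|x|x y z _ xy _ yz]; last exact: perm_trans xy yz.
  by rewrite perm_cat2l perm_cat2r (perm_catC [:: s] [:: t]).
exact: perm_refl.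
Qed.

Lemma comm_move_cons s u v : clos_refl_trans (seq S) (comm_move m) u v ->
  clos_refl_trans (seq S) (comm_move m) (s :: u) (s :: v).
Proof.
elim=> [_ _ [a b x y xy]|x|x y z _ xy _ yz]; last exact: rt_trans xy yz.
  by apply: rt_step; exact: (CommMove (s :: a) b xy).
exact: rt_refl.
Qed.

Lemma comm_move_front s u v :
  {in u, forall t, commute (coxeter_gen m s) (coxeter_gen m t)} ->
  clos_refl_trans (seq S) (comm_move m) (s :: u ++ v) (u ++ s :: v).
Proof.
elim: u => [|t u IHu] us; first exact: rt_refl.
apply: (@rt_trans _ _ _ (t :: s :: u ++ v)).
  by apply: rt_step; apply: (CommMove [::] (u ++ v)); apply: us; rewrite inE eqxx.
by apply: comm_move_cons; apply: IHu => x xu; apply: us; rewrite inE xu orbT.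
Qed.

Lemma comm_move_prod u v :
  clos_refl_trans (seq S) (comm_move m) u v -> word_prod m u = word_prod m v.
Proof.
elim=> [_ _ [a b s t st]|//|x y z _ -> _ ->//].
by rewrite !word_prod_cat !word_prod_cons !mulgA -!(mulgA (word_prod m a)) st.
Qed.

End ReducedWords.

(** * Simply-laced Coxeter groups and the numbers game *)

Section SimplyLaced.

Variables (S : choiceType) (m : coxeter_matrix S).
Hypothesis laced : forall s t, 0 < m s t <= 3.
Implicit Types (s t : S) (u v : seq S) (w : coxeter_group m) (f : S -> int).

Notation adj s := (fun t => m s t == 3).

Lemma adjC s t : (m s t == 3) = (m t s == 3).
Proof. by rewrite coxeter_m_sym. Qed.

Lemma adjxx s : (m s s == 3) = false.
Proof. by have /eqP -> : m s s == 1%N by rewrite coxeter_m_eq1. Qed.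

Lemma gen_commute s t :
  m s t != 3 -> commute (coxeter_gen m s) (coxeter_gen m t).
Proof.
move=> st3; have := gen_relation m s t; have := laced s t; rewrite /commute.
have [->//|st] := eqVneq s t; have := coxeter_m_eq1 m s t; rewrite (negPf st).
case: (m s t) st3 => [|[|[|[|k]]]] //= _ _ _; rewrite expg2 => /mulg1_eq <-.
by rewrite invgM; congr (_ * _)%g; apply: mulg1_eq; exact: gen_invol.
Qed.

Lemma gen_braid s t : m s t = 3 ->
  (coxeter_gen m s * (coxeter_gen m t * coxeter_gen m s) =
   coxeter_gen m t * (coxeter_gen m s * coxeter_gen m t))%g.
Proof.
move=> st3; have := gen_relation m s t; rewrite st3 !expgS expg0 mulg1.
set a := coxeter_gen m s; set b := coxeter_gen m t.
have ai : (a^-1 = a)%g by apply: mulg1_eq; exact: gen_invol.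
have bi : (b^-1 = b)%g by apply: mulg1_eq; exact: gen_invol.
rewrite !mulgA => E; have : (a * b * a * (b * a * b) = 1)%g by rewrite !mulgA.
by move/mulg1_eq/(congr1 (fun x => x^-1)%g); rewrite invgK !invgM ai bi !mulgA.
Qed.

(** The contragredient of the reflection representation, in which [f t] is
    the pairing of [f] with the simple root of [t] (the moves of Mozes's
    numbers game).  Unlike the reflection representation it needs no sum over
    the neighbours of [s], so the set of generators may be infinite.  A word
    acts by [foldr fire], its last letter first. *)
Definition fire s f : S -> int :=
  fun t => (if t == s then - f s else if m s t == 3 then f t + f s else f t)%R.

Lemma fire_relation s t f :
  foldr fire f (flatten (nseq (m s t) [:: s; t])) = f.
Proof.
apply/funext => x; have [<-|st] := eqVneq s t.
  have /eqP -> : m s s == 1%N by rewrite coxeter_m_eq1.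
  rewrite /= /fire eqxx; have [->|_] := eqVneq x s; first exact: opprK.
  by case: (m s x == 3); rewrite ?addrK.
have := laced s t; have := coxeter_m_eq1 m s t; rewrite (negPf st) => st1.
have [Ess Ett] := (adjxx s, adjxx t); have tsC := adjC s t.
have ts : t == s = false by rewrite eq_sym; exact: negPf.
case E : (m s t) st1 tsC => [|[|[|[|k]]]] //= _ tsC _;
  rewrite /fire !eqxx /= ?ts ?(negPf st) -?tsC ?E /=.
  have [->|xs] := eqVneq x s; rewrite ?(negPf st) -?tsC ?Ess ?Ett ?E /=;
    first lia.
  have [->|xt] := eqVneq x t; rewrite ?E /=; first lia.
  by case: (m s x == 3); case: (m t x == 3); lia.
have [->|xs] := eqVneq x s; rewrite ?(negPf st) -?tsC ?Ess ?Ett ?E /=;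
    first lia.
have [->|xt] := eqVneq x t; rewrite ?E /=; first lia.
by case: (m s x == 3); case: (m t x == 3); lia.
Qed.

Lemma fire_cong u v f : coxeter_cong m u v -> foldr fire f u = foldr fire f v.
Proof.
move=> uv; elim: uv f => {u v}
  [s t|u|u v _ IH|u v z _ IH1 _ IH2|u u' v v' _ IHu _ IHv] f //.
- exact: fire_relation.
- by rewrite IH1 IH2.
- by rewrite !foldr_cat IHv IHu.
Qed.

Lemma fire_prod u v f :
  word_prod m u = word_prod m v -> foldr fire f u = foldr fire f v.
Proof. by rewrite !word_prodE => /coxeter_classP; exact: fire_cong. Qed.

Lemma fire_inj s : injective (fire s).
Proof.
move=> f g fg; have := fire_relation s s; have /eqP -> : m s s == 1%N.
  by rewrite coxeter_m_eq1.
by move=> /= ss; rewrite -(ss f) fg ss.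
Qed.

(** The fundamental weight of [s]. *)
Definition weight s : S -> int := fun t => ((t == s)%:R)%R.

(** A generator [t] adds to a function a multiple of its value at [t], and the
    weight of [s] vanishes at [t] for [t] distinct from [s]. *)
Lemma weight_stable s u : s \notin u -> foldr fire (weight s) u = weight s.
Proof.
elim: u => //= t u IHu; rewrite inE negb_or => /andP[st /IHu ->].
apply/funext => x; rewrite /fire /weight (eq_sym t s) (negPf st).
by case: eqVneq => [->|_]; rewrite ?(eq_sym t s) ?(negPf st) ?addr0 ?if_same.
Qed.

Lemma weight_moved s a b : s \notin a -> s \notin b ->
  foldr fire (weight s) (a ++ s :: b) != weight s.
Proof.
move=> sa sb; rewrite foldr_cat /= (weight_stable sb) -{2}(weight_stable sa).
apply/eqP => E; have {E} : fire s (weight s) = weight s.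
  by elim: a {sa} E => //= t a IHa /fire_inj.
by move/(congr1 (@^~ s)); rewrite /fire /weight eqxx.
Qed.

(** If [v] avoided a letter [s] of [u], its product would fix the weight of
    [s]; but [u] moves it, because the only [s] in [u] does. *)
Lemma uniq_support u v : uniq u -> word_prod m u = word_prod m v ->
  {subset u <= v}.
Proof.
move=> uu uv s su; apply/negPn/negP => sv.
have /splitPr E := su; case: E uu uv => a b.
rewrite cat_uniq /= negb_or => /and3P[_ /andP[sa _] /andP[sb _]] /fire_prod uv.
by have /eqP[] := weight_moved sa sb; rewrite uv weight_stable.
Qed.

(** A shorter word with the same product would have to contain all the
    letters of [u]. *)
Lemma uniq_reduced u : uniq u -> reduced_expr u (word_prod m u).
Proof.
move=> uu; have [v vr] := reduced_exists (word_prod m u).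
apply: (reduced_eq_size vr) => //; apply/eqP; rewrite eqn_leq (reduced_le vr) //.
by rewrite andbT uniq_leq_size // => s; apply: uniq_support => //; case: vr.
Qed.

Lemma uniq_reduced_perm u v w : uniq u -> word_prod m u = w ->
  reduced_expr v w -> uniq v /\ perm_eq u v.
Proof.
move=> uu uw vw; have uv : {subset u <= v}.
  by apply: uniq_support => //; case: vw => ->.
have vu := reduced_le vw uw.
have [uvE vuE] := uniq_min_size uu uv vu.
have vv : uniq v by rewrite (leq_size_uniq uu uv vu).
by split=> //; apply: uniq_perm.
Qed.

(** Firing [s] on its weight leaves -1 at [s] and 1 at its neighbours.  A letter
    that has not been fired yet only gains, so each letter of a uniq word [v]
    fires with a nonnegative value, and a neighbour of [s] with a positive one,
    which is added to the value at [s]. *)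
Lemma fire_weight_ge s v : uniq v -> s \notin v ->
  let f := foldr fire (fire s (weight s)) v in
  ((has (adj s) v)%:R - 1 <= f s)%R /\
  forall t, t \notin v -> t != s -> ((m s t == 3)%:R <= f t)%R.
Proof.
elim: v => [|x v IHv] /=.
  move=> _ _; split=> [|t _ ts]; rewrite /fire /weight ?eqxx //.
  by rewrite (negPf ts); case: ifP.
case/andP=> xv uv; rewrite inE negb_or => /andP[sx sv].
have [IHs IHt] := IHv uv sv; have xs : x != s by rewrite eq_sym.
have := IHt x xv xs; set f := foldr _ _ _ in IHs IHt * => fx.
rewrite /fire (negPf sx) (adjC x s); split=> [|t].
  by case: (m s x == 3) fx => fx; case: (has _ _) IHs => /= IHs; lia.
rewrite inE negb_or => /andP[tx tv] ts; rewrite (negPf tx).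
have := IHt t tv ts.
by case: (m s t == 3); case: (m s x == 3) fx; case: ifP => _ /=; lia.
Qed.

(** Cancelling [s], the word [s v1 s v2] has the same product as [u], which
    fixes the weight of [s]; so [v1] must not change the value -1 at [s] of the
    fired weight, whereas a neighbour of [s] in [v1] would increase it. *)
Lemma uniq_first_commutes s u v1 v2 : uniq (s :: u) -> uniq (v1 ++ s :: v2) ->
  word_prod m (s :: u) = word_prod m (v1 ++ s :: v2) -> ~~ has (adj s) v1.
Proof.
move=> /= /andP[su uu]; rewrite cat_uniq /= negb_or.
case/and3P=> uv1 /andP[sv1 _] /andP[sv2 _] E; apply/negP => h.
have := fire_prod (weight s) E; rewrite /= foldr_cat /= !weight_stable //.
have [ge _] := fire_weight_ge uv1 sv1.
move/(congr1 (@^~ s)) => E'; rewrite -E' h in ge; move: ge.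
by rewrite /fire /weight eqxx.
Qed.

(** The first letter of [u] can be moved to the front of [v] and cancelled. *)
Lemma uniq_comm_equiv u v : uniq u -> uniq v -> perm_eq u v ->
  word_prod m u = word_prod m v -> clos_refl_trans (seq S) (comm_move m) u v.
Proof.
elim: u v => [|s u IHu] v uu uv puv E.
  have /perm_nilP -> : perm_eq v [::] by rewrite perm_sym.
  exact: rt_refl.
have sv : s \in v by rewrite -(perm_mem puv) inE eqxx.
have /splitPr D := sv; case: D uv puv E {sv} => v1 v2 uv puv E.
have nadj := uniq_first_commutes uu uv E.
have move_s : clos_refl_trans _ (comm_move m) (s :: v1 ++ v2) (v1 ++ s :: v2).
  apply: comm_move_front => t tv1; apply: gen_commute.
  by apply: contra nadj => ?; apply/hasP; exists t.
apply: rt_trans (move_s); apply: comm_move_cons; apply: IHu.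
- by case/andP: uu.
- by move: uv; rewrite uniq_catC cat_cons /= uniq_catC => /andP[].
- by move: puv; rewrite perm_sym (perm_catCA v1 [:: s] v2) perm_cons perm_sym.
- by move: E; rewrite -(comm_move_prod move_s) !word_prod_cons => /mulgI.
Qed.

Lemma uniq_fully_commutative u : uniq u -> fully_commutative (word_prod m u).
Proof.
move=> uu v v' vr vr'.
have [uv pv] := uniq_reduced_perm uu erefl vr.
have [uv' pv'] := uniq_reduced_perm uu erefl vr'.
apply: uniq_comm_equiv => //; last by case: vr vr' => -> _ [-> _].
by apply: perm_trans pv'; rewrite perm_sym.
Qed.

Lemma uniq_CFC u : uniq u -> CFC (word_prod m u).
Proof.
move=> uu v vr i; have ui : uniq (rot i v).
  by rewrite rot_uniq; case: (uniq_reduced_perm uu erefl vr).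
exists (word_prod m (rot i v)); first exact: uniq_reduced.
exact: uniq_fully_commutative.
Qed.

Lemma word_prod_front s u v : ~~ has (adj s) u ->
  word_prod m (u ++ s :: v) = word_prod m (s :: u ++ v).
Proof.
move=> uN; apply/esym/comm_move_prod/comm_move_front => t tu.
by apply: gen_commute; apply: contra uN => ?; apply/hasP; exists t.
Qed.

(** With no neighbour of [s] in the gap [x] the two [s] would meet and cancel;
    with exactly one neighbour [t] they would meet around it, and the braid
    relation would turn [s t s] into [t s t], with one [s] less. *)
Lemma fully_commutative_gap s x v w : fully_commutative w ->
  reduced_expr (s :: x ++ s :: v) w -> s \notin x -> 1 < count (adj s) x.
Proof.
move=> FC r sx; rewrite ltnNge; apply/negP => c1.
have [xN|] := boolP (has (adj s) x); last first.
  move=> xN; case: (r) => rw _.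
  have := reduced_le r (_ : word_prod m (x ++ v) = w).
  rewrite -rw !word_prod_cons word_prod_front // word_prod_cons.
  rewrite mulgA gen_invol mul1g.
  by move=> /(_ erefl); rewrite /= !size_cat /= addnS ltnNge leqnSn.
have [t tx st] := hasP xN; have /splitPr D := tx.
case: D c1 sx r {tx xN} => x1 x2; rewrite count_cat /= st => c1 sx r.
have x1N : ~~ has (adj s) x1 by rewrite has_count; lia.
have x2N : ~~ has (adj s) x2 by rewrite has_count; lia.
have r' : reduced_expr (x1 ++ t :: s :: t :: x2 ++ v) w.
  apply: (reduced_eq_size r); last by rewrite /= !size_cat /= !size_cat /=; lia.
  case: r => <- _; rewrite -catA cat_cons -word_prod_front // [LHS]word_prod_cat.
  rewrite [RHS]word_prod_cat; congr (_ * _)%g.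
  rewrite [RHS]word_prod_cons [in RHS]word_prod_cons word_prod_front //.
  rewrite !word_prod_cons; have := gen_braid (eqP st).
  by move=> /(congr1 (fun g => g * word_prod m (x2 ++ v))%g); rewrite -!mulgA.
have := comm_move_perm (FC _ _ r r'); move/permP/(_ (pred1 s)).
have ts : t == s = false.
  by apply: contraTF st => /eqP ->; rewrite adjxx.
by rewrite /= !count_cat /= !count_cat /= eqxx ts; lia.
Qed.

(** Each occurrence of [s] in the cyclic word [s v] is followed by a gap up to
    the next one, and these gaps are disjoint; the last gap is made visible by
    repeating [s] at the end. *)
Lemma gaps_count (N : pred S) s v :
  (forall a x b, s :: rcons v s = a ++ s :: x ++ s :: b -> s \notin x ->
     1 < count N x) ->
  2 * count_mem s (s :: v) <= count N (s :: v).
Proof.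
(* The induction on the unread part v keeps the part x of the current gap. *)
suff gen (x : seq S) : s \notin x ->
    (forall a y b, s :: x ++ rcons v s = a ++ s :: y ++ s :: b ->
       s \notin y -> 1 < count N y) ->
    2 * (count_mem s v).+1 <= count N x + count N v.
  by move=> gaps; have := gen [::] isT gaps; rewrite /= eqxx; lia.
elim: v x => [|t v IHv] x sx gaps /=.
  by have := gaps [::] x [::]; rewrite -cats1 => /(_ erefl sx); lia.
have [ts|ts] := eqVneq t s.
  have := gaps [::] x (rcons v s); rewrite ts => /(_ erefl sx).
  have := IHv [::] isT; rewrite add0n => IH xN.
  have {IH} : 2 * (count_mem s v).+1 <= count N v.
    apply: IH => a y b E; apply: (gaps (s :: x ++ a) _ b).
    by rewrite /= ts -catA -E.
  move=> cN; rewrite add1n mulnS; exact: leq_add xN (leq_trans cN (leq_addl _ _)).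
have := IHv (rcons x t); rewrite mem_rcons inE negb_or eq_sym ts cat_rcons.
by move=> /(_ sx gaps); rewrite -cats1 count_cat add0n /=; lia.
Qed.

(** The gap after any occurrence of [s] is brought to the front by a rotation,
    where [fully_commutative_gap] bounds it. *)
Lemma CFC_count s u w : CFC w -> reduced_expr u w -> 1 < count_mem s u ->
  2 * count_mem s u <= count (adj s) u.
Proof.
move=> cfc ru; have [su|/count_memPn -> //] := boolP (s \in u).
have [i v uv] := rot_to su; have /permP puv : perm_eq u (s :: v).
  by rewrite -uv perm_sym perm_rot.
rewrite !{}puv => s2; apply: gaps_count => a x b E sx.
have rot_gap z : (exists k, rot k (s :: v) = s :: x ++ s :: z) ->
    1 < count (adj s) x.
  case=> k; rewrite -uv rot_rot_add => rE.
  have [w' rw' FC] := cfc u ru (rot_add u i k); rewrite rE in rw'.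
  exact: fully_commutative_gap FC rw' sx.
case: (lastP b) E => [|b' t].
  case: a => [|t a] /=.
    rewrite cats1 => -[/rcons_inj[vx]]; move: s2; rewrite vx /= eqxx.
    by rewrite (count_memPn sx).
  rewrite (_ : a ++ _ = rcons (a ++ s :: x) s); last by rewrite -cats1 -catA.
  case=> ts /rcons_inj[vE]; subst t.
  apply: (rot_gap a); exists (size (s :: a)).
  by rewrite vE -cat_cons rot_size_cat.
rewrite (_ : a ++ _ = rcons (a ++ s :: x ++ s :: b') t); last first.
  by rewrite rcons_cat /= rcons_cat.
rewrite -rcons_cons => /rcons_inj[vE _].
by apply: (rot_gap (b' ++ a)); exists (size a); rewrite vE rot_size_cat /= -catA.
Qed.

End SimplyLaced.

(** * Counting elements with uniq words *)

Section MultiplicityFree.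

Variables (S : finType) (m : coxeter_matrix S).
Hypothesis laced : forall s t, 0 < m s t <= 3.
Implicit Types (s t v : S) (u : seq S) (w : coxeter_group m) (J : pred S).

Definition multfree J : set (coxeter_group m) :=
  [set w | exists2 u, word_prod m u = w & uniq u && all J u]%classic.

Definition multfree_poly J : {poly int} :=
  (\sum_(w \in multfree J) ('X : {poly int}) ^+ coxeter_length w)%R.

Lemma finite_multfree J : finite_set (multfree J).
Proof.
apply: (@sub_finite_set _ _
  ((fun u : #|S|.-bseq S => word_prod m u) @` setT)%classic); last first.
  exact/finite_image/finite_finset.
move=> w [u <- /andP[uu _]]; have su : size u <= #|S|.
  by rewrite -(card_uniqP uu) max_card.
by exists (Bseq su).
Qed.

Lemma length_word_prod u : uniq u -> coxeter_length (word_prod m u) = size u.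
Proof. by case/(uniq_reduced laced). Qed.

(** A letter [v] of a uniq word commutes with all other letters but its
    neighbour, so it can be moved to the front unless the neighbour stands
    before it, and then it can be moved to the end. *)
Lemma multfree_split J v : J v ->
    (forall s t, J s -> J t -> m v s = 3 -> m v t = 3 -> s = t) ->
    let K := predD1 J v in
  multfree J = (multfree K `|`
    ((fun w => coxeter_gen m v * w)%g @` multfree K `|`
    (fun w => w * coxeter_gen m v)%g @`
      (multfree K `\` multfree (fun s => K s && (m v s != 3)))))%classic.
Proof.
move=> Jv uniq_nbr K.
have KE u : all K u = (v \notin u) && all J u.
  by rewrite all_predI all_predC has_pred1.
apply/seteqP; split=> w; last first.
  case=> [[u <- /andP[uu Ku]]|[[_ [u <- /andP[uu Ku]] <-]|
    [_ [[u <- /andP[uu Ku]] _] <-]]]; move: Ku; rewrite KE => /andP[vu Ju].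
  - by exists u => //; rewrite uu.
  - by exists (v :: u); rewrite ?word_prod_cons //= vu uu Jv.
  - by exists (rcons u v); rewrite ?word_prod_rcons // rcons_uniq vu uu all_rcons Jv.
case=> u <- /andP[uu Ju]; have [/splitPr uE|vu] := boolP (v \in u); last first.
  by left; exists u => //; rewrite uu KE vu.
case: uE uu Ju => a b; rewrite uniq_catC cat_cons cons_uniq uniq_catC.
rewrite mem_cat orbC -mem_cat all_cat /= => /andP[vab uab] /and3P[Ja _ Jb]; right.
have Kab : uniq (a ++ b) && all K (a ++ b) by rewrite uab KE vab all_cat Ja.
have [/hasP[s sa /eqP vs]|aN] := boolP (has (fun t => m v t == 3) a); last first.
  left; exists (word_prod m (a ++ b)); first by exists (a ++ b).
  by rewrite (word_prod_front laced) // word_prod_cons.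
right; exists (word_prod m (a ++ b)).
  split; first by exists (a ++ b).
  case=> z zE /andP[_ /allP zN].
  have /zN : s \in z.
    by apply: (uniq_support laced uab (esym zE)); rewrite mem_cat sa.
  by rewrite vs eqxx andbF.
rewrite -word_prod_rcons -cats1 -catA !word_prod_cat; congr (_ * _)%g.
rewrite -word_prod_cat (word_prod_front laced) ?cats0 //.
apply/hasPn => t tb; apply/eqP => vt; move: uab; rewrite cat_uniq.
case/and3P=> _ /hasPn/(_ t tb)/negP[]; rewrite -(uniq_nbr s t) //.
  exact: (allP Ja).
exact: (allP Jb).
Qed.

(** Multiplication by [v] is injective and raises the length by one, so the
    three disjoint pieces of [multfree_split] contribute P(K), q P(K) and
    q (P(K) - P(L)), where L is K without the neighbours of [v]. *)
Lemma multfree_polyE J v : J v ->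
    (forall s t, J s -> J t -> m v s = 3 -> m v t = 3 -> s = t) ->
    let K := predD1 J v in
  multfree_poly J = ((1 + 2 * 'X) * multfree_poly K
    - 'X * multfree_poly (fun s => K s && (m v s != 3)))%R.
Proof.
move=> Jv uniq_nbr K; pose L s := K s && (m v s != 3).
have KE u : all K u = (v \notin u) && all J u.
  by rewrite all_predI all_predC has_pred1.
have LK : (multfree L `<=` multfree K)%classic.
  move=> _ [u <- /andP[uu]]; rewrite all_predI => /andP[Ku _].
  by exists u => //; rewrite uu.
have fK := finite_multfree K.
have fKL := finite_setD (multfree L) fK.
pose left_mul w := (coxeter_gen m v * w)%g.
pose right_mul w := (w * coxeter_gen m v)%g.
pose A := (left_mul @` multfree K)%classic.
pose B := (right_mul @` (multfree K `\` multfree L))%classic.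
have fA : finite_set A by exact: finite_image.
have fB : finite_set B by exact: finite_image.
have disj1 : (multfree K `&` (A `|` B) `<=` set0)%classic.
  move=> w [[u <- /andP[uu]]]; rewrite KE => /andP[vu _] ABu.
  suff : v \in u by rewrite (negPf vu).
  case: ABu => [[_ [x <- /andP[ux]]]|[_ [[x <- /andP[ux]] + _]]];
    rewrite KE => /andP[vx _] E.
    apply: (@uniq_support _ _ laced (v :: x)); rewrite ?inE ?eqxx //= ?vx //.
    by rewrite word_prod_cons.
  apply: (@uniq_support _ _ laced (rcons x v)); rewrite ?mem_rcons ?inE ?eqxx //.
    by rewrite rcons_uniq vx.
  by rewrite word_prod_rcons.
(* A common element would have words v x and y v; by uniq_first_commutes no
   letter of y is adjacent to v, so y has its letters in L. *)
have disj2 : (A `&` B `<=` set0)%classic.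
  move=> w [[_ [x <- /andP[ux Kx]] <-] [_ [[y <- /andP[uy Ky]] yN]]].
  move: Kx (Ky); rewrite !KE => /andP[vx _] /andP[vy _].
  rewrite /left_mul /right_mul -word_prod_rcons -word_prod_cons -cats1 => E.
  apply: yN; exists y => //; rewrite uy all_predI Ky /=.
  rewrite -[all _ y]negbK -has_predC.
  apply: contraNN (_ : ~~ has (fun s => m v s == 3) y).
    by apply: sub_has => t /negbNE.
  apply: (@uniq_first_commutes _ _ laced v x y [::]) (esym E); rewrite /= ?vx //.
  by rewrite cats1 rcons_uniq vy.
rewrite /multfree_poly (multfree_split Jv uniq_nbr) -/K -/L -/A -/B.
rewrite fsbigU0 ?finite_setU // fsbigU0 //.
rewrite !fsbig_image; last 2 first.
- by move=> x y _ _; exact: mulIg.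
- by move=> x y _ _; exact: mulgI.
have lenl w : multfree K w ->
    coxeter_length (coxeter_gen m v * w)%g = (coxeter_length w).+1.
  case=> u <-; rewrite KE => /and3P[uu vu _].
  by rewrite -word_prod_cons !length_word_prod //= vu.
have lenr w : multfree K w ->
    coxeter_length (w * coxeter_gen m v)%g = (coxeter_length w).+1.
  case=> u <-; rewrite KE => /and3P[uu vu _].
  by rewrite -word_prod_rcons !length_word_prod ?size_rcons // rcons_uniq vu.
have len_left :
    (\sum_(w \in multfree K) ('X : {poly int}) ^+ coxeter_length (left_mul w) =
     'X * multfree_poly K)%R.
  rewrite mulr_fsumr; apply: eq_fsbigr => w /set_mem wK.
  by rewrite /left_mul lenl // exprS.
have len_right :
    (\sum_(w \in multfree K `\` multfree L)
       ('X : {poly int}) ^+ coxeter_length (right_mul w) =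
     'X * (multfree_poly K - multfree_poly L))%R.
  rewrite /multfree_poly (fsbigID (multfree L) _ _ fK).
  have -> : (multfree K `&` multfree L = multfree L)%classic by apply/setIidPr.
  rewrite [in RHS]addrC addKr -setDE mulr_fsumr.
  apply: eq_fsbigr => w /set_mem[wK _].
  by rewrite /right_mul lenr // exprS.
rewrite len_left len_right -/(multfree_poly K) -/(multfree_poly L).
by rewrite /=; ring.
Qed.

Lemma eq_multfree_poly J K : J =1 K -> multfree_poly J = multfree_poly K.
Proof. by move=> /funext ->. Qed.

Lemma multfree_poly0 : multfree_poly pred0 = 1%R.
Proof.
rewrite /multfree_poly (_ : multfree pred0 = [set 1%g]%classic).
  rewrite fsbig_set1; have := @length_word_prod [::] isT.
  by rewrite /word_prod big_nil => ->.
apply/seteqP; split=> [_ [u <-]|_ ->].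
  by rewrite all_pred0 => /andP[_ /nilP ->]; rewrite /word_prod big_nil.
by exists [::]; rewrite // /word_prod big_nil.
Qed.

End MultiplicityFree.

(** * Type D *)

Section TypeD.

Variable r : nat.
Notation D := (typeD r).

Lemma typeD_laced (i j : 'I_r) : (0 < D i j <= 3)%N.
Proof. by rewrite /= /typeD_m; case: ifP => // _; case: ifP. Qed.

Lemma typeD_adj (i j : 'I_r) :
  (D i j == 3) = typeD_edge i j || typeD_edge j i.
Proof.
rewrite /= /typeD_m; have [->|_] := eqVneq i j; last by case: ifP.
by rewrite /typeD_edge /=; lia.
Qed.

(** On the long leg, [dec] says that c drops by at least one from a value above
    1 to the next vertex outwards: 2 c(i+1) <= c(i) + c(i+2) is a convexity
    condition, and c vanishes beyond the end of the leg.  At the branch vertex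
    2, c(2) > 1 would then force c(0) + c(1) > c(2), whereas
    c(0), c(1) <= max(1, c(2) / 2). *)
Lemma typeD_counts (c : nat -> nat) :
  (forall i, (r <= i)%N -> c i = 0) ->
  ((1 < c 0)%N -> (2 * c 0 <= c 2)%N) ->
  ((1 < c 1)%N -> (2 * c 1 <= c 2)%N) ->
  ((1 < c 2)%N -> (2 * c 2 <= c 0 + c 1 + c 3)%N) ->
  (forall i, (1 < c i.+3)%N -> (2 * c i.+3 <= c i.+2 + c i.+4)%N) ->
  forall i, (c i <= 1)%N.
Proof.
move=> c_out c0 c1 c2 cS.
have dec i : (1 < c i.+2)%N -> (c i.+3 < c i.+2)%N.
  have [k] := ubnP (r - i); elim: k i => // k IHk i ik ci.
  have ir : (i < r)%N.
    by rewrite ltnNge; apply/negP => ri; move: ci; rewrite c_out; lia.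
  have := IHk i.+1; have := cS i; lia.
have le2 : (c 2 <= 1)%N by have := dec 0; lia.
have leS i : (c i.+2 <= 1)%N.
  by elim: i => // i IHi; have := dec i.+1; have := cS i; lia.
by case=> [|[|i]]; [lia|lia|exact: leS].
Qed.

Lemma typeD_CFC_uniq (u : seq 'I_r) (w : coxeter_group D) :
  CFC w -> reduced_expr u w -> uniq u.
Proof.
move=> cfc ru; pose c k := count (fun i : 'I_r => val i == k) u.
have cE (i : 'I_r) : count_mem i u = c i by [].
have c_out i : (r <= i)%N -> c i = 0.
  move=> ri; apply/eqP; rewrite -leqn0 leqNgt -has_count; apply/hasPn => j _.
  by rewrite neq_ltn (leq_trans (ltn_ord j) ri).
have bound k (P : pred nat) :
    (forall j : 'I_r, typeD_edge k j || typeD_edge j k -> P (val j)) -> (1 < c k)%N ->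
    (2 * c k <= count (fun i : 'I_r => P i) u)%N.
  move=> nbr ck; have kr : (k < r)%N.
    by rewrite ltnNge; apply/negP => rk; move: ck; rewrite c_out.
  have := CFC_count typeD_laced (s := Ordinal kr) cfc ru; rewrite cE => /(_ ck).
  move=> /leq_trans; apply; apply: sub_count => j /=.
  by move=> /(_ =P 3) E; apply: nbr; rewrite -(typeD_adj (Ordinal kr) j); apply/eqP.
have c_or a b : (count (fun i : 'I_r => (val i == a) || (val i == b)) u <= c a + c b)%N.
  by rewrite -count_predUI leq_addr.
apply: count_mem_uniq => i.
suff : (c i <= 1)%N.
  by rewrite cE -cE; case: (boolP (i \in u)); rewrite -has_pred1 has_count; lia.
apply: typeD_counts => // [||| k].
- apply: (bound 0 (eq_op^~ 2)) => j; rewrite /typeD_edge /=; lia.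
- apply: (bound 1 (eq_op^~ 2)) => j; rewrite /typeD_edge /=; lia.
- move=> /(@bound 2 (fun j => [|| j == 0, j == 1 | j == 3])) H.
  apply: leq_trans (H _) _; first by move=> j; rewrite /typeD_edge /=; lia.
  rewrite -addnA; apply: leq_trans (leq_add (leqnn _) (c_or _ _)).
  by rewrite -count_predUI leq_addr.
- move=> /(@bound k.+3 (fun j => (j == k.+2) || (j == k.+4))) H.
  by apply: leq_trans (H _) (c_or _ _) => j; rewrite /typeD_edge /=; lia.
Qed.

Lemma typeD_CFC_multfree (w : coxeter_group D) :
  CFC w <-> exists2 u, reduced_expr u w & uniq u.
Proof.
split=> [cfc|[u [<- _] uu]]; last exact: uniq_CFC typeD_laced _ uu.
by have [u ru] := reduced_exists w; exists u => //; exact: typeD_CFC_uniq ru.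
Qed.

Lemma D_CFC_multfree : D_CFC r = multfree_poly D predT.
Proof.
apply: eq_fsbigl; apply/seteqP; split=> w /=.
  by case/typeD_CFC_multfree=> u [<- _] uu; exists u; rewrite // uu all_predT.
case=> u <- /andP[uu _]; apply/typeD_CFC_multfree; exists u => //.
exact: uniq_reduced typeD_laced _ uu.
Qed.

(* Predicates on nat make the conditions on vertex sets linear arithmetic. *)
Notation P J := (multfree_poly D (fun i : 'I_r => J (val i))).

Lemma typeD_poly_split (J K L : pred nat) v : v < r -> J v ->
    (forall i, K i = J i && (i != v)) ->
    (forall i, L i = K i && ~~ (typeD_edge v i || typeD_edge i v)) ->
    (forall i j, J i -> J j -> typeD_edge v i || typeD_edge i v ->
       typeD_edge v j || typeD_edge j v -> i = j) ->
  (P J = (1 + 2 * 'X) * P K - 'X * P L)%R.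
Proof.
move=> vr Jv KE LE nbr.
rewrite (@multfree_polyE _ _ typeD_laced _ (Ordinal vr)) //.
  congr (_ * _ - _ * _)%R; apply: eq_multfree_poly => i.
    by rewrite KE /= andbC.
  by rewrite LE KE -(typeD_adj (Ordinal vr)) /= (andbC (J i)).
move=> i j Ji Jj /eqP; rewrite typeD_adj => vi /eqP; rewrite typeD_adj => vj.
exact/val_inj/(nbr _ _ Ji Jj).
Qed.

Lemma typeD_poly0 : (P (fun=> false) = 1)%R.
Proof. by rewrite -(multfree_poly0 typeD_laced); exact: eq_multfree_poly. Qed.

Lemma typeD_poly1 v : v < r -> (P (eq_op^~ v) = 1 + 'X)%R.
Proof.
move=> vr; rewrite (@typeD_poly_split _ (fun=> false) (fun=> false) v) //=.
- by rewrite typeD_poly0; ring.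
- by move=> i; case: eqP.
- by move=> i j /eqP -> /eqP ->.
Qed.

End TypeD.

Local Open Scope ring_scope.

(** * Generating polynomials *)

Fixpoint typeD_poly (k : nat) : {poly int} :=
  match k with
  | 0 => 1
  | 1 => 1 + 'X
  | 2 => (1 + 'X) ^+ 2
  | 3 => 1 + 3 * 'X + 5 * 'X ^+ 2 + 4 * 'X ^+ 3
  | ((k1.+2 as k2).+1 as k3).+1 => (1 + 2 * 'X) * typeD_poly k3 - 'X * typeD_poly k2
  end.

(** The generators below [k] generate a group of type D of rank [k]; counting
    inside the fixed group of rank [r] avoids comparing the two groups. *)
Lemma typeD_poly_initial r k : (k <= r)%N ->
  multfree_poly (typeD r) (fun i : 'I_r => (val i < k)%N) = typeD_poly k.
Proof.
have [n] := ubnP k; elim: n k => // n IHn [|[|[|[|k]]]] kn kr.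
- exact: typeD_poly0.
- rewrite [RHS]/= -(typeD_poly1 kr); apply: eq_multfree_poly => i /=; lia.
- rewrite (@typeD_poly_split _ (fun i => (i < 2)%N) (fun i => (i < 1)%N)
    (fun i => (i < 1)%N) 1) //=.
  + by rewrite IHn ?(ltnW kr) //=; ring.
  + lia.
  + move=> i; rewrite /typeD_edge /=; lia.
  + move=> i j; rewrite /typeD_edge /=; lia.
(* In rank 3 the last vertex has two neighbours; the leaves 0 and 1 are
   removed instead. *)
- rewrite (@typeD_poly_split _ (fun i => (i < 3)%N) (fun i => (i == 1%N) || (i == 2%N))
    (fun i => i == 1%N) 0) //=; first last.
  + move=> i j; rewrite /typeD_edge /=; lia.
  + move=> i; rewrite /typeD_edge /=; lia.
  + lia.
  + lia.
  rewrite (@typeD_poly_split _ (fun i => (i == 1%N) || (i == 2%N))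
    (fun i => i == 2%N) (fun=> false) 1) //=; first last.
  + move=> i j; rewrite /typeD_edge /=; lia.
  + move=> i; rewrite /typeD_edge /=; lia.
  + lia.
  + lia.
  by rewrite typeD_poly0 !typeD_poly1 ?(ltnW kr) //; ring.
rewrite (@typeD_poly_split _ (fun i => (i < k.+4)%N) (fun i => (i < k.+3)%N)
  (fun i => (i < k.+2)%N) k.+3) //.
- by rewrite !IHn //; lia.
- lia.
- move=> i; rewrite /typeD_edge /=; lia.
- move=> i j; rewrite /typeD_edge /=; lia.
Qed.

Lemma D_CFC_poly r : D_CFC r = typeD_poly r.
Proof.
rewrite D_CFC_multfree -(@typeD_poly_initial r) //; apply: eq_multfree_poly => i.
by rewrite /= ltn_ord.
Qed.

(** * The generating function *)

Section FormalPowerSeries.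

Variable R : comUnitRingType.
Implicit Types (c : R) (a : fps R).

Lemma fps_constD c d : fps_const c + fps_const d = fps_const (c + d).
Proof. by apply: fpsP => -[|n] //=; rewrite addr0. Qed.

Lemma fps_coef_const c a n : fps_coef (fps_const c * a) n = c * fps_coef a n.
Proof.
rewrite fps_coefM big_ord_recl subn0 big1 ?addr0 // => i _.
by rewrite mul0r.
Qed.

Lemma fps_constM c d : fps_const c * fps_const d = fps_const (c * d).
Proof.
by apply: fpsP => n; rewrite fps_coef_const; case: n => //= n; rewrite mulr0.
Qed.

Lemma fps_coefX0 a : fps_coef (fpsX R * a) 0 = 0.
Proof. by rewrite fps_coefM big_ord1 mul0r. Qed.

Lemma fps_coefXS a n : fps_coef (fpsX R * a) n.+1 = fps_coef a n.
Proof.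
rewrite fps_coefM !big_ord_recl mul0r add0r mul1r big1 ?addr0 ?subn1 // => i _.
by rewrite mul0r.
Qed.

End FormalPowerSeries.

Theorem proposition3p5 :
  [/\ (forall (n : nat) (w : coxeter_group (typeD n.+1)),
         CFC w <-> exists2 u, reduced_expr u w & uniq u),
      (let q : {poly int} := 'X in
       [/\ D_CFC 1 = 1 + q,
           D_CFC 2 = 1 + 2 * q + q ^+ 2,
           D_CFC 3 = 1 + 3 * q + 5 * q ^+ 2 + 4 * q ^+ 3
         & forall n : nat, (3 <= n)%N ->
             D_CFC n.+1 = (2 * q + 1) * D_CFC n - q * D_CFC n.-1])
    & (let q : fps {poly int} := fps_const 'X in
       let x : fps {poly int} := fpsX {poly int} in
       Fps (fun n => D_CFC n.+1)
       = ((1 + q) - x * q * (1 + q) + x ^+ 2 * q ^+ 2 * (1 + 2 * q))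
         / (1 - (2 * q + 1) * x + q * x ^+ 2))].
Proof.
split=> [n w||]; first exact: typeD_CFC_multfree.
  move=> /=; split=> [|||[|[|[|n]]] // _]; rewrite !D_CFC_poly //=; ring.
move=> q x; set F := Fps _; set den := 1 - _ + _; set num := _ + _ * (1 + 2 * q).
have den_unit : den \is a GRing.unit.
  rewrite fps_unitE; suff -> : fps_coef den 0 = 1 by exact: unitr1.
  have -> : den = 1 + x * (q * x - (2 * q + 1)) by rewrite /den; ring.
  by rewrite fps_coefD fps_coefX0 addr0.
apply: (canRL (mulrK den_unit)).
have c1 : fps_const (1 + 'X) = 1 + q by rewrite -fps_constD.
have c2 : fps_const (1 + 2 * 'X) = 1 + 2 * q.
  by rewrite -fps_constD -fps_constM -fps_constD.
have denE : F * den = F - fps_const (1 + 2 * 'X) * (x * F)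
    + fps_const 'X * (x * (x * F)).
  by rewrite c2 -/q /den; ring.
have numE : num = fps_const (1 + 'X) - x * fps_const ('X * (1 + 'X))
    + x * (x * fps_const ('X ^+ 2 * (1 + 2 * 'X))).
  by rewrite -!fps_constM c1 c2 -/q /num; ring.
rewrite denE numE; apply: fpsP => n.
have coefN a : fps_coef (- a) n = - fps_coef a n by [].
case: n coefN => [|[|[|n]]] coefN;
  rewrite !(fps_coefD, coefN, fps_coef_const, fps_coefX0, fps_coefXS) /=.
all: by rewrite !D_CFC_poly /=; ring.
Qed.
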